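(* Consider SCMs $\langle \mathbf{V}=\{\mathbf{X},Y\},\mathbf{U},\mathcal{F},P_{\mathbf{u}}\rangle$ with treatments $\mathbf{X}=\{X_1,\dots,X_n\}$ and outcome $Y$, where $X_i=f_i(Pa(X_i))+U_i$ for $i=1,\dots,n$, $Y=f_Y(\mathbf{X})+U_Y$, and $P_{\mathbf{u}}\sim\mathcal{N}(\mu,\Sigma)$, with a given causal graph $G$. Suppose the observational distribution and the interventional distributions $P[\mathbf{V}\setminus\mathbf{S}\mid do(\mathbf{S})]$ for $\mathbf{S}$ in some collection $\mathcal{I}$ of subsets of $\mathbf{X}$ are available (so $\emptyset\in\mathcal{I}$). Then all estimands of the form $\mathbb{E}[Y\mid do(\mathbf{W})]$ with $\mathbf{W}\subseteq\mathbf{X}$ are identifiable from the available distributions if and only if the available distributions include the joint interventional distribution $P[Y\mid do(\mathbf{X})]$ and, for every treatment $X_i\in\mathbf{X}$, an interventional distribution $P[\mathbf{V}\setminus\mathbf{S}_i\mid do(\mathbf{S}_i)]$ with $X_i\notin\mathbf{S}_i$ and $Pa(X_i)\subseteq\mathbf{S}_i$.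
   Context: A structural causal model (SCM) $\mathcal{M}=\langle\{\mathbf{X},Y\},\mathbf{U},\mathcal{F},P_{\mathbf{u}}\rangle$ consists of observed variables (real-valued treatments $\mathbf{X}=\{X_1,\dots,X_n\}$ and a real-valued outcome $Y$), unobserved noise variables $\mathbf{U}=(U_1,\dots,U_n,U_Y)$ with joint distribution $P_{\mathbf{u}}$, and deterministic structural equations $\mathcal{F}$. Its causal graph $G$ is the directed graph on $\mathbf{V}=\{\mathbf{X},Y\}$ with an edge from each variable in $Pa(V)$ to $V$; it is acyclic. No treatment is a descendant of $Y$, so $Pa(X_i)\subseteq\mathbf{X}$, and all treatments are taken to be parents of $Y$. The model is a confounded additive noise model (ANM) with Gaussian noise: each variable is a deterministic function ($f_i$, $f_Y$) of its parents plus its noise term, and $\mathbf{U}$ is jointly Gaussian $\mathcal{N}(\mu,\Sigma)$; the components of $\mathbf{U}$ may be correlated and $\mu$ need not be zero. An intervention $do(\mathbf{W}=\mathbf{w})$ replaces the structural equations of the variables in $\mathbf{W}$ by the constants $\mathbf{w}$, leaving everything else (including $P_{\mathbf{u}}$) unchanged. $P[\mathbf{V}\setminus\mathbf{W}\mid do(\mathbf{W})]$ denotes the resulting joint distribution of the remaining variables, for all values $\mathbf{w}$; $do(\emptyset)$ gives the observational distribution. $\mathbb{E}[Y\mid do(\mathbf{W})]$ (the average causal effect, ACE) is the mean of $Y$ under $do(\mathbf{W}=\mathbf{w})$, as a function of $\mathbf{w}$. Identifiability: given the causal graph $G$ and interventional distributions for a collection $\mathcal{I}$ of intervention target sets, a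 quantity is not identifiable if and only if there exist two models $\mathcal{M}_1,\mathcal{M}_2$ in the class considered (SCMs with $X_i=f_i(Pa(X_i))+U_i$ for $i=1,\dots,n$, $Y=f_Y(\mathbf{X})+U_Y$, and $(U_1,\dots,U_n,U_Y)$ jointly Gaussian with arbitrary mean and covariance) that both have causal graph $G$ and agree on the interventional distributions for all targets in $\mathcal{I}$, but assign different values to the quantity. Otherwise it is identifiable, i.e. any two models of the class with graph $G$ agreeing on these distributions agree on the quantity. *)

(* Defs.v *)
From HB Require Import structures.
From mathcomp Require Import all_boot all_order all_algebra.
From mathcomp Require Import all_classical all_reals all_analysis.

Set Implicit Arguments.
Unset Strict Implicit.
Unset Printing Implicit Defensive.

Import Order.TTheory GRing.Theory Num.Theory.

Local Open Scope ring_scope.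

(* [subvec A x] is the subvector x_A, listed in the order of [enum A]. *)
Definition subvec (T : Type) (n : nat) (A : {set 'I_n}) (x : n.-tuple T) :
    #|A|.-tuple T :=
  [tuple tnth x (enum_val k) | k < #|A|].

(* The vertices of the causal graph are 'I_n.+1: the treatments X_1, ..., X_n
   come first, the outcome Y is the last vertex. Noise vectors
   (U_1, ..., U_n, U_Y) are indexed in the same way. *)
Definition treatment (n : nat) (i : 'I_n) : 'I_n.+1 := lift ord_max i.
Definition outcome (n : nat) : 'I_n.+1 := ord_max.

Record causal_graph (n : nat) (G : rel 'I_n.+1) : Prop := {
  acyclic_graph : forall v w, G v w -> ~~ connect G w v;
  treatments_outcome : forall i : 'I_n, G (treatment i) (outcome n);
  outcome_no_desc : forall i : 'I_n, ~~ connect G (outcome n) (treatment i) }.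

Definition Pa (n : nat) (G : rel 'I_n.+1) (i : 'I_n) : {set 'I_n} :=
  [set j | G (treatment j) (treatment i)]%SET.

(* The normal law with mean m and variance v, possibly degenerate: the library's
   [normal_prob m 0] is not the Dirac mass at m. *)
Definition normal_law (R : realType) (m v : R) : set R -> \bar R :=
  if v == 0 then \d_m else normal_prob m (Num.sqrt v).

(* P = N(mu, Sigma), with Sigma possibly singular: every linear form t.U is
   normal with mean t.mu and variance t Sigma t^T. *)
Definition gaussian (R : realType) (m : nat) (mu : 'rV[R]_m) (Sigma : 'M[R]_m)
    (P : probability (m.-tuple R) R) : Prop :=
  [/\ Sigma^T = Sigma,
      forall t : 'rV[R]_m, 0 <= (t *m Sigma *m t^T) 0 0 &
      forall (t : 'rV[R]_m) (A : set R), measurable A ->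
        pushforward P (fun u => \sum_(i < m) t 0 i * tnth u i) A =
        normal_law ((t *m mu^T) 0 0) ((t *m Sigma *m t^T) 0 0) A].

Section Models.
Variables (R : realType) (n : nat) (G : rel 'I_n.+1).

(* Additive noise models with causal graph G. The structural function of X_i
   takes the vector of its parents; all treatments are parents of Y. As Pa(V)
   lists the arguments of the structural function of V, this function is not
   required to depend effectively on each of them. *)
Record anm := ANM {
  fX : forall i : 'I_n, #|Pa G i|.-tuple R -> R;
  fY : n.-tuple R -> R;
  noise : probability (n.+1.-tuple R) R;
  noise_mean : 'rV[R]_n.+1;
  noise_cov : 'M[R]_n.+1;
  measurable_fX : forall i : 'I_n, measurable_fun setT (@fX i);
  measurable_fY : measurable_fun setT fY;
  noise_gaussian : gaussian noise_mean noise_cov noise }.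

Arguments fX : clear implicits.

Implicit Types (M : anm) (S W : {set 'I_n}) (w : n.-tuple R)
  (u : n.+1.-tuple R) (x : n.-tuple R).

(* The structural equations of the treatments under do(X_S = w_S); the
   coordinates of w outside S are irrelevant. *)
Definition structural_eqs M S w u x : Prop :=
  forall i : 'I_n, tnth x i =
    if i \in S then tnth w i
    else fX M i (subvec (Pa G i) x) + tnth u (treatment i).

Lemma structural_eqs_unique M S w u : causal_graph G ->
  exists! x, structural_eqs M S w u x.
Proof.
case=> acycG _ _.
pose anc (i : 'I_n) := #|[set v | connect G v (treatment i)]%SET|.
have ancP i j : j \in Pa G i -> (anc j < anc i)%N.
  rewrite inE => Gji; apply/proper_card/properP; split.
    by apply/fintype.subsetP => v; rewrite !inE => /connect_trans; apply; exact: connect1.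
  by exists (treatment i); rewrite inE ?connect0//; exact: acycG Gji.
pose step x : n.-tuple R := [tuple if i \in S then tnth w i
  else fX M i (subvec (Pa G i) x) + tnth u (treatment i) | i < n].
have stepP x y i : (forall j, (anc j < anc i)%N -> tnth x j = tnth y j) ->
    tnth (step x) i = tnth (step y) i.
  move=> xy; rewrite !tnth_mktuple; case: ifP => // _; congr (fX M i _ + _).
  apply: eq_from_tnth => k; rewrite !tnth_mktuple.
  by apply/xy/ancP/enum_valP.
have fixP x : structural_eqs M S w u x <-> step x = x.
  split=> [eqx|eqx i]; first by apply: eq_from_tnth => i; rewrite tnth_mktuple eqx.
  by rewrite -{1}eqx tnth_mktuple.
have iterP k i : (anc i <= k)%N ->
    tnth (iter k step w) i = tnth (iter k.+1 step w) i.
  elim: k i => [|k IHk] i ik.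
    have : (0 < anc i)%N by apply/card_gt0P; exists (treatment i); rewrite inE.
    by rewrite ltnNge ik.
  by apply: stepP => j ji; apply: IHk; rewrite -ltnS (leq_trans ji).
have fix_iter : step (iter n.+1 step w) = iter n.+1 step w.
  apply: eq_from_tnth => i; apply/esym/iterP.
  by rewrite -[leqRHS]card_ord max_card.
exists (iter n.+1 step w); split; first exact/fixP.
move=> y /fixP eqy; apply: eq_from_tnth => i.
have [k] := ubnP (anc i); elim: k i => // k IHk i ik.
by rewrite -eqy -fix_iter; apply: stepP => j ji; apply: IHk; rewrite (leq_trans ji).
Qed.

(* By [structural_eqs_unique] the default value w is never used. *)
Definition doX M S w u : n.-tuple R :=
  xget w [set x | structural_eqs M S w u x]%classic.

Definition doY M S w u : R := fY M (doX M S w u) + tnth u (outcome n).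

(* P[V \ S | do(S = w_S)] *)
Definition interventional M S w : set (#|~: S|.-tuple R * R) -> \bar R :=
  pushforward (noise M)
    (fun u => (subvec (~: S) (doX M S w u), doY M S w u)).

Arguments interventional : clear implicits.

(* E[Y | do(W = w_W)] as a function of w. The library's expectation is total
   and extended-real valued, so no integrability of Y is presupposed. *)
Definition ACE W M : n.-tuple R -> \bar R :=
  fun w => expectation (noise M) (doY M W w).

Definition agree_on (I : {set {set 'I_n}}) M1 M2 : Prop :=
  forall S, S \in I -> forall w (A : set (#|~: S|.-tuple R * R)),
    measurable A -> interventional M1 S w A = interventional M2 S w A.

Definition identifiable (I : {set {set 'I_n}}) (T : Type) (q : anm -> T) : Prop :=
  forall M1 M2, agree_on I M1 M2 -> q M1 = q M2.

End Models.

(* Main.v *)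
Require Import Defs.
From HB Require Import structures.
From mathcomp Require Import all_boot all_order all_algebra.
From mathcomp Require Import all_classical all_reals all_analysis.
From mathcomp Require Import measurable_realfun ring.

(* Sufficiency: P[Y | do(X)] and the laws P[. | do(S_i)] determine f_Y and every
   f_i up to an additive constant, since no law on the line is invariant under a
   nonzero shift. As U is a function of the observed (X, Y), the observational
   law then forces the noise of the second model to be the noise of the first
   one shifted by these constants, and the shifts cancel in every do(W).

   Necessity: take U = Z a with Z a standard normal variable and a a 0/1 vector.
   If X is not in I, the outcome functions 0 and 1_{x = 0} differ under do(X = 0)
   but give the same law whenever some X_j = Z is left free, as Z is almost
   surely nonzero. If no S in I with X_i not in S contains Pa(X_i), the functions
   0 and 1_{pa = 0} for X_i, with U_i = U_Y = 0 and Y = X_i, differ under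
   do(Pa(X_i) = 0) and cannot be told apart for the same reason. *)

Set Implicit Arguments.
Unset Strict Implicit.
Unset Printing Implicit Defensive.

Import Order.TTheory GRing.Theory Num.Theory.
Import numFieldNormedType.Exports.

Local Open Scope ring_scope.

(** * Measure theory: shifted laws, scaled normal laws, expectations of images *)

Lemma measure_eq_off_null d (T : measurableType d) (R : realType)
    (mu : {measure set T -> \bar R}) (N A B : set T) :
  measurable N -> mu N = 0%E -> measurable A -> measurable B ->
  (forall z, ~ N z -> A z <-> B z) -> mu A = mu B.
Proof.
move=> mN N0 mA mB AB; rewrite -(measureU0 mA mN N0) -(measureU0 mB mN N0).
congr (mu _); apply/seteqP.
by split=> z; (have [|nNz] := pselect (N z); [by right|];
  case=> [/(AB z nNz)|]; [left|right]).
Qed.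

Lemma measurable_preimage d1 d2 (T1 : measurableType d1)
    (T2 : measurableType d2) (f : T1 -> T2) (A : set T2) :
  measurable_fun setT f -> measurable A -> measurable (f @^-1` A)%classic.
Proof. by move=> mf mA; rewrite -[X in measurable X]setTI; exact: mf. Qed.

(** A nonzero [e] would make the distribution function of [X] periodic, which contradicts its limits
    0 at minus infinity and 1 at plus infinity. *)
Lemma shift_invariant_law0 d (T : measurableType d) (R : realType)
    (P : probability T R) (X : T -> R) (e : R) : measurable_fun setT X ->
  (forall A, measurable A ->
    P (X @^-1` A)%classic = P ((fun t => X t + e) @^-1` A)%classic) ->
  e = 0.
Proof.
move=> mX; wlog e0 : e / 0 < e.
  move=> wl inv; have [e0|e0|//] := ltgtP e 0; last exact: wl.
  apply/eqP; rewrite -oppr_eq0; apply/eqP/wl => [|A mA].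
    by rewrite oppr_gt0.
  have mA' : measurable ((fun r => r - e) @^-1` A)%classic.
    by apply: measurable_preimage => //; exact: measurable_funB.
  rewrite [RHS](inv _ mA'); congr (P _); apply/seteqP.
  by split=> t /=; rewrite addrK.
move=> inv.
pose Xm : {RV P >-> R} := HB.pack X (isMeasurableFun.Build _ _ _ _ X mX).
have Xe (r : R) : cdf Xm r = cdf Xm (r + e).
  rewrite /cdf /distribution /pushforward/= [RHS]inv//.
  by congr (P _); apply/seteqP; split=> t /=; rewrite !in_itv/= lerD2r.
have Xk (k : nat) (r : R) : cdf Xm (r + e *+ k) = cdf Xm r.
  by elim: k => [|k IHk]; rewrite ?addr0// mulrSr addrA -Xe.
have oo : ((e *+ k : R) @[k --> \oo] --> +oo%R)%classic.
  apply/cvgryPge => r; near=> k.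
  rewrite -mulr_natr mulrC -ler_pdivrMr//.
  near: k; exact: nbhs_infty_ger.
have c1 : (cdf Xm (e *+ k) @[k --> \oo] --> 1%E)%classic.
  exact: (cvg_comp _ _ oo (cvg_cdfy1 Xm)).
have c0 : (cdf Xm (- (e *+ k)) @[k --> \oo] --> 0%E)%classic.
  apply: (cvg_comp _ _ _ (cvg_cdfNy0 Xm)).
  apply/cvgNry; move: oo; rewrite (_ : (fun _ => _) = - (fun k => - (e *+ k)))//.
  by apply/funext => k; rewrite fctE opprK.
(* The two arguments are [k + k] periods apart, so one sequence would tend both to 0 and to 1. *)
have same : (fun k => cdf Xm (- (e *+ k))) = (fun k => cdf Xm (e *+ k)).
  by apply/funext => k; rewrite -(Xk (k + k)%N) mulrnDr addKr.
rewrite same in c0.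
have /eqP : 0%E = 1%E :> \bar R.
  exact: (cvg_unique (@ereal_hausdorff R) c0 c1).
by rewrite eq_sym onee_eq0.
Unshelve. all: by end_near. Qed.

(** The laws of [g2 k + X2] and [g2 l + X2] are translates of each other. Carried over to [X1] by
    the hypothesis at [k] and at [l], this makes the law of [g1 l + X1] invariant under the shift by
    [(g1 k - g2 k) - (g1 l - g2 l)], which must therefore vanish. *)
Lemma additive_noise_shift (d1 d2 : measure_display) (T1 : measurableType d1)
    (T2 : measurableType d2) (R : realType) (P1 : probability T1 R)
    (P2 : probability T2 R) (X1 : T1 -> R) (X2 : T2 -> R) (K : Type)
    (g1 g2 : K -> R) :
  measurable_fun setT X1 ->
  (forall k A, measurable A -> P1 ((fun t => g1 k + X1 t) @^-1` A)%classic =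
                               P2 ((fun t => g2 k + X2 t) @^-1` A)%classic) ->
  forall k l, g1 k - g2 k = g1 l - g2 l.
Proof.
move=> mX1 eqg k l; apply/eqP; rewrite -subr_eq0; apply/eqP.
apply: (@shift_invariant_law0 _ _ _ P1 (fun t => g1 l + X1 t)) => [|A mA].
  exact: measurable_funD.
pose s r := r + (g2 l - g2 k).
have mA' : measurable (s @^-1` A)%classic.
  by apply: measurable_preimage => //; exact: measurable_funD.
rewrite eqg//.
transitivity (P2 ((fun t => g2 k + X2 t) @^-1` (s @^-1` A))%classic).
  congr (P2 _); apply/seteqP.
  by split=> t /=; rewrite /s addrAC subrKC.
rewrite -eqg//; congr (P1 _); apply/funext => t /=; congr A.
by rewrite /s; ring.
Qed.

(** By uniqueness of Lebesgue measure it suffices to compare the two sides on half-open intervals. A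
    negative [c] moves the closed end to the other side, which does not affect the length. *)
Lemma lebesgue_measure_scale (R : realType) (c : R) (A : set R) : c != 0 ->
  measurable A ->
  lebesgue_measure A =
  (`|c|%:E * lebesgue_measure ((fun x => c * x)%R @^-1` A)%classic)%E.
Proof.
move=> c0 mA.
have mc :
    measurable_fun setT (fun x : measurableTypeR R => c * x : measurableTypeR R).
  exact: measurable_funM.
pose nu : {measure set (measurableTypeR R) -> \bar R} :=
  mscale (NngNum (normr_ge0 c)) (pushforward lebesgue_measure
   (fun x : measurableTypeR R => c * x : measurableTypeR R)).
transitivity (nu mc A); last by [].
apply: lebesgue_measure_unique => //= _ [[a b]] _ <-.
rewrite /nu /mscale/= /pushforward.
have [c_gt0|c_lt0|/eqP] := ltgtP 0 c; last by rewrite eq_sym (negPf c0).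
- rewrite (_ : _ @^-1` _ = `]c^-1 * a, c^-1 * b]%classic)%classic; last first.
    by apply/seteqP; split=> x /=; rewrite !in_itv/= ltr_pdivrMl// ler_pdivlMl.
  rewrite !lebesgue_measure_itv/= !lte_fin ltr_pM2l ?invr_gt0// gtr0_norm//.
  case: ifP => _; last by rewrite mule0.
  by rewrite -!EFinB -EFinM mulrBr !mulVKf.
- rewrite (_ : _ @^-1` _ = `[c^-1 * b, c^-1 * a[%classic)%classic; last first.
    apply/seteqP.
    by split=> x /=; rewrite !in_itv/= ltr_ndivlMl// ler_ndivrMl// andbC.
  rewrite !lebesgue_measure_itv/= !lte_fin ltr_nM2l ?invr_lt0// ltr0_norm//.
  case: ifP => _; last by rewrite mule0.
  by rewrite -!EFinB -EFinM mulrBr !mulNr !mulVKf// opprK addrC.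
Qed.

Lemma normal_pdf_scale (R : realType) (c x : R) : c != 0 ->
  `|c| * normal_pdf 0 `|c| (c * x) = normal_pdf 0 1 x.
Proof.
move=> c0; rewrite !normal_pdfE ?normr_eq0 ?oner_eq0//.
rewrite /normal_peak /normal_fun !subr0 expr1n mul1r.
rewrite -normrX [`|c ^+ 2|]ger0_norm ?sqr_ge0// exprMn.
rewrite -[_ * pi *+ 2]mulrnAr sqrtrM ?sqr_ge0// sqrtr_sqr invfM !mulrA.
rewrite divff ?normr_eq0// mul1r; congr (_ * expR _).
rewrite -[c ^+ 2 *+ 2]mulr_natr; field; exact: c0.
Qed.

(** Change of variables: the Jacobian [|c|] turns the density with deviation [|c|] into the standard
    one. The sign of [c] is irrelevant because the centred density is even. *)
Lemma normal_prob_scale (R : realType) (c : R) (A : set R) : c != 0 ->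
  measurable A ->
  normal_prob 0 `|c| A = normal_prob 0 1 ((fun x => c * x) @^-1` A)%classic.
Proof.
move=> c0 mA; rewrite /normal_prob.
have mc :
    measurable_fun setT (fun x : measurableTypeR R => c * x : measurableTypeR R).
  exact: measurable_funM.
have mpdf m s :
    measurable_fun setT (fun x : measurableTypeR R => (normal_pdf m s x)%:E).
  by apply/measurable_EFinP; exact: measurable_normal_pdf.
pose mu : {measure set (measurableTypeR R) -> \bar R} := @lebesgue_measure R.
rewrite (eq_measure_integral (mscale (NngNum (normr_ge0 c)) (pushforward mu
   (fun x : measurableTypeR R => c * x : measurableTypeR R)))); last first.
  by move=> B mB _; exact: lebesgue_measure_scale.
have pdf0 m s (x : measurableTypeR R) : (0 <= (normal_pdf m s x)%:E)%E.
  by rewrite lee_fin normal_pdf_ge0.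
rewrite ge0_integral_mscale//=; last exact: measurable_funTS.
rewrite ge0_integral_pushforward//=; last exact: measurable_funTS.
rewrite -ge0_integralZl//=.
- by apply: eq_integral => x _; rewrite -EFinM normal_pdf_scale.
- exact: measurable_preimage mA.
- by apply: measurable_funTS; exact: (measurableT_comp (mpdf _ _)).
Qed.

Lemma expectation_image_law d1 d2 (T1 : measurableType d1)
    (T2 : measurableType d2) (R : realType) (P1 : probability T1 R)
    (P2 : probability T2 R) (phi : T1 -> T2) (Y : T2 -> R) :
  measurable_fun setT phi -> measurable_fun setT Y ->
  (forall B, measurable B -> P2 B = P1 (phi @^-1` B)%classic) ->
  expectation P2 Y = expectation P1 (Y \o phi).
Proof.
move=> mphi mY P12; rewrite unlock.
pose Xphi : {mfun T1 >-> T2} :=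
  HB.pack phi (isMeasurableFun.Build _ _ _ _ phi mphi).
rewrite (eq_measure_integral (distribution P1 Xphi)); last first.
  by move=> B mB _; exact: P12.
have mEY : measurable_fun setT (fun t => (Y t)%:E) by exact/measurable_EFinP.
(* No integrability is assumed, so the positive and negative parts are transported separately by the
   formula for nonnegative functions. *)
rewrite integralE [RHS]integralE; congr (_ - _)%E.
- rewrite ge0_integral_pushforward ?preimage_setT//; last first.
    exact: measurable_funepos.
  by rewrite -funepos_comp.
- rewrite ge0_integral_pushforward ?preimage_setT//; last first.
    exact: measurable_funeneg.
  by rewrite -funeneg_comp.
Qed.

(** * Subvectors, and solutions of the structural equations *)

Lemma tnth_subvec (T : Type) n (A : {set 'I_n}) i (Ai : i \in A)
    (x : n.-tuple T) :
  tnth (subvec A x) (enum_rank_in Ai i) = tnth x i.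
Proof. by rewrite tnth_mktuple enum_rankK_in. Qed.

Lemma eq_subvec (T : Type) n (A : {set 'I_n}) (x y : n.-tuple T) :
  {in A, forall i, tnth x i = tnth y i} -> subvec A x = subvec A y.
Proof.
by move=> xy; apply: eq_from_tnth => k; rewrite !tnth_mktuple xy ?enum_valP.
Qed.

Lemma measurable_subvec d (T : measurableType d) (R : realType) n
    (A : {set 'I_n}) (X : T -> n.-tuple R) :
  {in A, forall i, measurable_fun setT (fun t => tnth (X t) i)} ->
  measurable_fun setT (fun t => subvec A (X t)).
Proof.
move=> mX; apply/measurable_fun_tnthP => k.
rewrite (_ : _ \o _ = fun t => tnth (X t) (enum_val k)).
  by apply: mX; exact: enum_valP.
by apply/funext => t /=; rewrite tnth_mktuple.
Qed.

Section Graph.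
Context (n : nat) (G : rel 'I_n.+1) (hG : causal_graph G).

(** Induction on the number of ancestors: a parent [j] of [i] has strictly fewer, since by
    acyclicity [i] is an ancestor of itself but not of [j]. *)
Lemma parent_ind (P : 'I_n -> Prop) :
  (forall i, (forall j, j \in Pa G i -> P j) -> P i) -> forall i, P i.
Proof.
case: hG => acycG _ _ IH i.
have [k] := ubnP #|[set v | connect G v (treatment i)]%SET|.
elim: k i => // k IHk i ik; apply: IH => j; rewrite inE => Gji.
apply: IHk; rewrite -ltnS; apply: leq_trans ik; rewrite ltnS.
apply/proper_card/properP; split.
  apply/fintype.subsetP => v; rewrite !inE => /connect_trans; apply.
  exact: connect1.
by exists (treatment i); rewrite inE ?connect0//; exact: acycG Gji.
Qed.

Lemma notin_Pa i : i \notin Pa G i.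
Proof.
case: hG => acycG _ _; rewrite inE; apply/negP => Gii.
by have := acycG _ _ Gii; rewrite connect0.
Qed.

Context (R : realType).
Implicit Types (M : anm R G) (S W : {set 'I_n}) (w x : n.-tuple R)
  (u : n.+1.-tuple R).

Lemma doXP M S w u : structural_eqs M S w u (doX M S w u).
Proof.
have [x [eqx _]] := structural_eqs_unique M S w u hG.
by apply: (xgetPex w); exists x.
Qed.

Lemma doX_eq M S w u x : structural_eqs M S w u x -> doX M S w u = x.
Proof.
have [y [_ uniqy]] := structural_eqs_unique M S w u hG.
by move=> /uniqy <-; rewrite (uniqy _ (doXP M S w u)).
Qed.

(** The choice made by [xget] says nothing about measurability; the equations do, as they express
    each coordinate through its parents, so induction along the graph applies. *)
Lemma measurable_doX M S w : measurable_fun setT (doX M S w).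
Proof.
apply/measurable_fun_tnthP; apply: parent_ind => i IH.
rewrite (_ : _ \o _ = fun u => if i \in S then tnth w i else
  fX M (subvec (Pa G i) (doX M S w u)) + tnth u (treatment i)); last first.
  by apply/funext => u /=; exact: doXP.
case: (i \in S); first exact: measurable_cst.
apply: measurable_funD; last exact: measurable_tnth.
apply: (measurableT_comp (@measurable_fX _ _ _ M i)).
exact: measurable_subvec.
Qed.

Lemma measurable_doY M S w : measurable_fun setT (doY M S w).
Proof.
apply: measurable_funD; last exact: measurable_tnth.
exact: (measurableT_comp (measurable_fY M) (measurable_doX M S w)).
Qed.

Lemma measurable_do M S w :
  measurable_fun setT (fun u => (subvec (~: S)%SET (doX M S w u), doY M S w u)).
Proof.
apply/measurable_fun_pair; last exact: measurable_doY.
apply: measurable_subvec => i _.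
exact: (measurableT_comp (measurable_tnth i) (measurable_doX M S w)).
Qed.

(** * Sufficiency: the available laws determine the models up to shifts *)

Section Sufficiency.
Variables (I : {set {set 'I_n}}) (M1 M2 : anm R G).
Hypotheses (hI : finset.set0 \in I) (agr : agree_on I M1 M2).

(** Under [do(S = w)] all parents of [i] are held at [w] while [X_i] itself stays observed, so this
    law is a marginal of the interventional distribution. *)
Lemma treatment_law i S w (B : set R) :
  S \in I -> i \notin S -> Pa G i \subset S ->
  measurable B ->
  noise M1 ((fun u => fX M1 (subvec (Pa G i) w) + tnth u (treatment i))
    @^-1` B)%classic =
  noise M2 ((fun u => fX M2 (subvec (Pa G i) w) + tnth u (treatment i))
    @^-1` B)%classic.
Proof.
move=> SI iS PaS mB; have iCS : i \in ~: S by rewrite inE.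
pose X (p : #|~: S|.-tuple R * R) := tnth p.1 (enum_rank_in iCS i).
have mX : measurable_fun setT X.
  exact: (measurableT_comp (measurable_tnth _) measurable_fst).
have XE M u : X (subvec (~: S)%SET (doX M S w u), doY M S w u) =
    fX M (subvec (Pa G i) w) + tnth u (treatment i).
  rewrite /X tnth_subvec doXP (negPf iS); congr (fX M _ + _).
  apply: eq_subvec => j /(fintype.subsetP PaS) jS.
  by rewrite doXP jS.
transitivity (@interventional R n G M1 S w (X @^-1` B)%classic).
  by congr (noise M1 _); apply/funext => u; rewrite /= -/(X _) XE.
rewrite agr//; last exact: measurable_preimage.
by congr (noise M2 _); apply/funext => u; rewrite /= -/(X _) XE.
Qed.

Lemma outcome_law w (B : set R) : [set: 'I_n]%SET \in I -> measurable B ->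
  noise M1 ((fun u => fY M1 w + tnth u (outcome n)) @^-1` B)%classic =
  noise M2 ((fun u => fY M2 w + tnth u (outcome n)) @^-1` B)%classic.
Proof.
move=> TI mB.
have YE M u : doY M [set: 'I_n]%SET w u = fY M w + tnth u (outcome n).
  by rewrite /doY (@doX_eq _ _ _ _ w)// => i; rewrite inE.
transitivity (@interventional R n G M1 [set: 'I_n]%SET w (snd @^-1` B)%classic).
  by congr (noise M1 _); apply/funext => u; rewrite /= YE.
rewrite agr//; last exact: measurable_preimage.
by congr (noise M2 _); apply/funext => u; rewrite /= YE.
Qed.

Lemma ACE_eq W : [set: 'I_n]%SET \in I ->
  (forall i, exists S, [/\ S \in I, i \notin S & Pa G i \subset S]) ->
  ACE W M1 = ACE W M2.
Proof.
move=> TI hS; apply/funext => w.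
pose w0 : n.-tuple R := [tuple 0 | i < n].
(* The constant gap between the structural functions of the two models, read off at the arbitrary
   base point [w0]. *)
pose c (v : 'I_n.+1) : R := if unlift ord_max v is Some i
  then fX M1 (subvec (Pa G i) w0) - fX M2 (subvec (Pa G i) w0)
  else fY M1 w0 - fY M2 w0.
have cX i x : fX M1 (subvec (Pa G i) x) =
    fX M2 (subvec (Pa G i) x) + c (treatment i).
  rewrite /c /treatment liftK; have [S [SI iS PaS]] := hS i.
  rewrite -(@additive_noise_shift _ _ _ _ R (noise M1) (noise M2)
    (fun u => tnth u (treatment i)) (fun u => tnth u (treatment i)) _
    (fun x => fX M1 (subvec (Pa G i) x)) (fun x => fX M2 (subvec (Pa G i) x))
    _ _ x) ?subrKC//; first exact: measurable_tnth.
  by move=> k B mB; exact: (treatment_law k SI).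
have cY x : fY M1 x = fY M2 x + c (outcome n).
  rewrite /c /outcome unlift_none.
  rewrite -(@additive_noise_shift _ _ _ _ R (noise M1) (noise M2)
    (fun u => tnth u (outcome n)) (fun u => tnth u (outcome n)) _
    (fY M1) (fY M2)
    _ _ x) ?subrKC//; first exact: measurable_tnth.
  by move=> k B mB; exact: outcome_law.
(* Moving the gaps into the noise turns the equations of [M1] at [u] into those of [M2] at [tau u],
   under every intervention. It remains to see that [tau] carries the noise law of [M1] to that of
   [M2]. *)
pose tau (u : n.+1.-tuple R) : n.+1.-tuple R :=
  [tuple c v + tnth u v | v < n.+1].
have mtau : measurable_fun setT tau.
  apply/measurable_fun_tnthP => v.
  rewrite (_ : _ \o _ = fun u => c v + tnth u v).
    by apply: measurable_funD => //; exact: measurable_tnth.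
  by apply/funext => u /=; rewrite tnth_mktuple.
have doXtau S x u : doX M1 S x u = doX M2 S x (tau u).
  apply: doX_eq => i; rewrite doXP; case: ifP => // _.
  by rewrite tnth_mktuple cX addrA.
have doYtau S x : doY M1 S x = doY M2 S x \o tau.
  by apply/funext => u; rewrite /doY /= doXtau cY tnth_mktuple addrA.
have iC0 i : i \in ~: (finset.set0 : {set 'I_n}) by rewrite !inE.
pose C0 := (~: (finset.set0 : {set 'I_n}))%SET.
pose X (p : #|C0|.-tuple R * R) : n.-tuple R :=
  [tuple tnth p.1 (enum_rank_in (iC0 i) i) | i < n].
(* Noise recovered from an observation as the residuals with respect to [M2]. Applied to
   observations of [M1], it returns [tau u]. *)
pose U (p : #|C0|.-tuple R * R) : n.+1.-tuple R :=
  [tuple if unlift ord_max v is Some i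
         then tnth (X p) i - fX M2 (subvec (Pa G i) (X p))
         else p.2 - fY M2 (X p) | v < n.+1].
have mX : measurable_fun setT X.
  apply/measurable_fun_tnthP => i.
  rewrite (_ : _ \o _ = fun p => tnth p.1 (enum_rank_in (iC0 i) i)).
    exact: (measurableT_comp (measurable_tnth _) measurable_fst).
  by apply/funext => p /=; rewrite tnth_mktuple.
have mXi i : measurable_fun setT (fun p => tnth (X p) i).
  exact: (measurableT_comp (measurable_tnth _) mX).
have mU : measurable_fun setT U.
  apply/measurable_fun_tnthP => v.
  rewrite (_ : _ \o _ = fun p => if unlift ord_max v is Some i
         then tnth (X p) i - fX M2 (subvec (Pa G i) (X p))
         else p.2 - fY M2 (X p)); last first.
    by apply/funext => p /=; rewrite tnth_mktuple.
  case: (unlift ord_max v) => [i|]; apply: measurable_funB => //.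
    apply: (measurableT_comp (@measurable_fX _ _ _ M2 i)).
    exact: measurable_subvec.
  exact: (measurableT_comp (measurable_fY M2) mX).
pose obs M u := (subvec C0 (doX M finset.set0 w0 u), doY M finset.set0 w0 u).
have Uobs u : U (obs M2 u) = u.
  have XE : X (obs M2 u) = doX M2 finset.set0 w0 u.
    by apply: eq_from_tnth => i; rewrite tnth_mktuple tnth_subvec.
  apply: eq_from_tnth => v; rewrite tnth_mktuple XE.
  case: unliftP => [i|] ->.
    by rewrite {1}doXP inE addrAC subrr add0r.
  by rewrite /= /doY addrAC subrr add0r.
have obs1 u : obs M1 u = obs M2 (tau u) by rewrite /obs doXtau doYtau.
rewrite /ACE doYtau; apply/esym/expectation_image_law => // [|B mB].
  exact: measurable_doY.
(* Both noise laws are now images of the observational law, on which the models agree because the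
   empty set lies in [I]. *)
transitivity (noise M2 (obs M2 @^-1` (U @^-1` B))%classic).
  by congr (noise M2 _); apply/funext => u; rewrite /= Uobs.
transitivity (noise M1 (obs M1 @^-1` (U @^-1` B))%classic).
  by apply/esym/(agr hI); exact: measurable_preimage.
by congr (noise M1 _); apply/funext => u; rewrite /= obs1 Uobs.
Qed.

End Sufficiency.
End Graph.

(** * Gaussian noise concentrated on a line *)

Section Line.
Context (R : realType) (m : nat) (a : 'rV[R]_m).

Definition line (z : measurableTypeR R) : m.-tuple R :=
  [tuple z * a 0 i | i < m].

Lemma measurable_line : measurable_fun setT line.
Proof.
apply/measurable_fun_tnthP => i; rewrite (_ : _ \o _ = fun z => z * a 0 i).
  exact: measurable_funM.
by apply/funext => z /=; rewrite tnth_mktuple.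
Qed.

HB.instance Definition _ := isMeasurableFun.Build _ _ _ _ line measurable_line.

Definition line_prob : probability (m.-tuple R) R :=
  distribution (normal_prob 0 1) line.

(** A linear form [t] takes the value [s * z] on the line, where [s] is the scalar product of [t]
    and [a]; its variance is [s ^+ 2]. For [s = 0] the law is the Dirac mass at 0, the degenerate
    branch of [normal_law]. *)
Lemma gaussian_line : gaussian 0 (a^T *m a) line_prob.
Proof.
have var (t : 'rV[R]_m) :
    (t *m (a^T *m a) *m t^T) 0 0 = (\sum_i t 0 i * a 0 i) ^+ 2.
  rewrite mulmxA -mulmxA mxE big_ord1 expr2 !mxE; congr (_ * _).
    by apply: eq_bigr => i _; rewrite mxE.
  by apply: eq_bigr => i _; rewrite mxE mulrC.
split=> [|t|t A mA]; first by rewrite trmx_mul trmxK.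
  by rewrite var sqr_ge0.
rewrite var trmx0 mulmx0 mxE /normal_law sqrf_eq0 sqrtr_sqr.
set s := \sum_i _.
rewrite [LHS](_ : _ = normal_prob 0 1 ((fun z => s * z) @^-1` A)%classic);
  last first.
  congr (normal_prob 0 1 _); apply/funext => z /=; congr A.
  rewrite /s mulr_suml; apply: eq_bigr => i _.
  by rewrite tnth_mktuple mulrCA mulrC.
have [->|s0] := eqVneq s 0; last by rewrite normal_prob_scale.
under eq_fun do rewrite mul0r.
rewrite preimage_cst diracE; case: ifPn => _; first exact: probability_setT.
by rewrite measure0.
Qed.

End Line.

Lemma normal_prob_set1 (R : realType) (m s r : R) :
  normal_prob m s [set r]%classic = 0%E.
Proof. exact: integral_set1. Qed.

(** * Necessity: indistinguishable models with different causal effects *)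

Section Necessity.
Context (R : realType) (n : nat) (G : rel 'I_n.+1) (hG : causal_graph G).
Variables (a : 'rV[R]_n.+1) (M1 M2 : anm R G).
Hypotheses (noise1 : noise M1 = line_prob a) (noise2 : noise M2 = line_prob a).

(** Models that differ only at [z = 0] have the same laws, since a standard normal variable avoids 0
    almost surely. *)
Lemma agree_on_line (I : {set {set 'I_n}}) :
  (forall S w z, S \in I -> z != 0 ->
     doX M1 S w (line a z) = doX M2 S w (line a z) /\
     doY M1 S w (line a z) = doY M2 S w (line a z)) -> agree_on I M1 M2.
Proof.
move=> eqM S SI w A mA; rewrite /interventional noise1 noise2.
apply: (@measure_eq_off_null _ _ R (normal_prob 0 1) [set 0]%classic) => //.
- exact: normal_prob_set1.
- apply: (measurable_preimage (measurable_line a)).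
  exact: (measurable_preimage (measurable_do hG M1 w)).
- apply: (measurable_preimage (measurable_line a)).
  exact: (measurable_preimage (measurable_do hG M2 w)).
- by move=> z /eqP z0 /=; have [-> ->] := eqM S w z SI z0.
Qed.

End Necessity.

Lemma ACE_line (R : realType) n (G : rel 'I_n.+1) (hG : causal_graph G)
    (a : 'rV[R]_n.+1) (M : anm R G) W w (r : R) :
  noise M = line_prob a -> (forall z, doY M W w (line a z) = r) ->
  ACE W M w = r%:E.
Proof.
move=> noiseM doYr; rewrite /ACE.
rewrite (@expectation_image_law _ _ _ _ R (normal_prob 0 1) _ (line a)).
- rewrite (_ : _ \o _ = cst r) ?expectation_cst//.
  by apply/funext => z; exact: doYr.
- exact: measurable_line.
- exact: measurable_doY.
- by move=> B mB; rewrite noiseM.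
Qed.

(** The sum of absolute values reduces the test to one real number, which makes measurability
    immediate. On the empty tuple the value is 1, so treatments without parents need no separate
    case. *)
Definition zero_indicator (R : realType) m (t : m.-tuple R) : R :=
  ((\sum_i `|tnth t i|) == 0)%:R.

Lemma zero_indicator0 (R : realType) m (t : m.-tuple R) i :
  tnth t i != 0 -> zero_indicator t = 0.
Proof.
move=> ti; rewrite /zero_indicator psumr_eq0//; case: allP => // /(_ i).
by rewrite mem_index_enum normr_eq0 (negPf ti) => /(_ isT).
Qed.

Lemma zero_indicator1 (R : realType) m (t : m.-tuple R) :
  (forall i, tnth t i = 0) -> zero_indicator t = 1.
Proof.
by move=> t0; rewrite /zero_indicator big1 ?eqxx// => i _; rewrite t0 normr0.
Qed.

Lemma measurable_zero_indicator (R : realType) m :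
  measurable_fun setT (@zero_indicator R m).
Proof.
rewrite (_ : @zero_indicator R m =
  \1_[set 0]%classic \o fun t => \sum_i `|tnth t i|).
  apply: measurableT_comp; first exact: measurable_indic.
  apply: measurable_sum => i.
  by apply: measurableT_comp => //; exact: measurable_tnth.
apply/funext => t; rewrite /zero_indicator /= indicE; congr (_%:R).
by rewrite classical_sets.in_set1.
Qed.

Lemma full_intervention_needed (R : realType) n (G : rel 'I_n.+1)
    (hG : causal_graph G) (I : {set {set 'I_n}}) :
  identifiable I (@ACE R n G [set: 'I_n]%SET) -> [set: 'I_n]%SET \in I.
Proof.
move=> idI; apply/negPn/negP => TI.
(* Every treatment has noise [z] and the outcome has none. *)
pose a : 'rV[R]_n.+1 := \row_v (v != ord_max)%:R.
pose f (i : 'I_n) (t : #|Pa G i|.-tuple R) : R := 0.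
have mf i : measurable_fun setT (f i) by exact: measurable_cst.
have m0 : measurable_fun setT (fun _ : n.-tuple R => 0 : R).
  exact: measurable_cst.
pose M1 : anm R G := ANM mf m0 (gaussian_line a).
pose M2 : anm R G := ANM mf (@measurable_zero_indicator R n) (gaussian_line a).
have aY z : tnth (line a z) (outcome n) = 0.
  by rewrite tnth_mktuple mxE eqxx mulr0.
have aX z i : tnth (line a z) (treatment i) = z.
  by rewrite tnth_mktuple mxE eq_sym neq_lift mulr1.
have agr : agree_on I M1 M2.
  apply: (@agree_on_line _ _ _ hG a) => // S w z SI z0; split => //.
  rewrite /doY; congr (_ + _) => /=.
  (* As [S] is not the full set, some treatment [j] is left free and equals [z], which is nonzero,
     so the indicator vanishes. *)
  have /fintype.subsetPn[j _ jS] : ~~ ([set: 'I_n]%SET \subset S).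
    by rewrite finset.subTset; apply: contraNneq TI => <-.
  rewrite (@zero_indicator0 _ _ _ j)// (doXP hG M2) (negPf jS) /= /f add0r aX.
  exact: z0.
(* Under [do(X = 0)] the outcome is constantly 0 in [M1] and constantly 1 in [M2]. *)
have := congr1 (fun q => q [tuple 0 | _ < n]) (idI _ _ agr).
rewrite (@ACE_line _ _ _ hG a _ _ _ 0)//; last first.
  by move=> z; rewrite /doY aY addr0.
rewrite (@ACE_line _ _ _ hG a _ _ _ 1)//; last first.
  move=> z; rewrite /doY aY addr0 /= zero_indicator1// => i.
  by rewrite (doXP hG M2) inE tnth_mktuple.
by move=> [] /eqP; rewrite eq_sym oner_eq0.
Qed.

Lemma parents_intervention_needed (R : realType) n (G : rel 'I_n.+1)
    (hG : causal_graph G) (I : {set {set 'I_n}}) (i : 'I_n) :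
  identifiable I (@ACE R n G (Pa G i)) ->
  exists S, [/\ S \in I, i \notin S & Pa G i \subset S].
Proof.
move=> idI; apply: contrapT => noS.
(* No noise on [Y] or on [X_i], so that [Y = X_i] shows exactly the value of the structural function
   of [X_i]; all other treatments have noise [z]. *)
pose a : 'rV[R]_n.+1 := \row_v ((v != ord_max) && (v != treatment i))%:R.
pose f1 (k : 'I_n) (t : #|Pa G k|.-tuple R) : R := 0.
have mf1 k : measurable_fun setT (f1 k) by exact: measurable_cst.
pose f2 (k : 'I_n) (t : #|Pa G k|.-tuple R) : R :=
  if k == i then zero_indicator t else 0.
have mf2 k : measurable_fun setT (f2 k).
  rewrite /f2; case: (k == i); last exact: measurable_cst.
  exact: measurable_zero_indicator.
have mi : measurable_fun setT (fun x : n.-tuple R => tnth x i).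
  exact: measurable_tnth.
pose M1 : anm R G := ANM mf1 mi (gaussian_line a).
pose M2 : anm R G := ANM mf2 mi (gaussian_line a).
have aY z : tnth (line a z) (outcome n) = 0.
  by rewrite tnth_mktuple mxE eqxx mulr0.
have ai z : tnth (line a z) (treatment i) = 0.
  by rewrite tnth_mktuple mxE eqxx andbF mulr0.
have aX z k : k != i -> tnth (line a z) (treatment k) = z.
  move=> ki; rewrite tnth_mktuple mxE eq_sym neq_lift /=.
  by rewrite (inj_eq (@lift_inj _ _)) ki mulr1.
have agr : agree_on I M1 M2.
  apply: (@agree_on_line _ _ _ hG a) => // S w z SI z0.
  suff doXE : doX M1 S w (line a z) = doX M2 S w (line a z).
    by rewrite /doY doXE.
  (* By uniqueness it is enough that the solution for [M1] satisfies the equations of [M2]. Only the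
     equation of [X_i] differs, and only when [i] is not in [S]; then some parent [j] of [i] lies
     outside [S] and equals [z]. *)
  apply/esym/(doX_eq hG) => k; rewrite (doXP hG M1); case: ifPn => // kS.
  congr (_ + _); rewrite /= /f1 /f2; case: eqVneq => // ki; subst k.
  have /fintype.subsetPn[j jPa jS] : ~~ (Pa G i \subset S).
    by apply/negP => PaS; apply: noS; exists S.
  have ji : j != i by apply: contraTneq jPa => ->; exact: notin_Pa.
  rewrite (@zero_indicator0 _ _ _ (enum_rank_in jPa j))//.
  by rewrite tnth_subvec (doXP hG M1) (negPf jS) /= /f1 add0r aX.
(* Under [do(Pa(X_i) = 0)] the variable [X_i] is not intervened on, and [Y = X_i] is constantly 0 in
   [M1] and constantly 1 in [M2]. *)
have := congr1 (fun q => q [tuple 0 | _ < n]) (idI _ _ agr).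
have iPa := negPf (notin_Pa hG i).
rewrite (@ACE_line _ _ _ hG a _ _ _ 0)//; last first.
  by move=> z; rewrite /doY aY addr0 /= (doXP hG M1) iPa ai addr0.
rewrite (@ACE_line _ _ _ hG a _ _ _ 1)//; last first.
  move=> z; rewrite /doY aY addr0 /= (doXP hG M2) iPa ai addr0 /= /f2 eqxx.
  rewrite zero_indicator1// => k.
  by rewrite tnth_mktuple (doXP hG M2) enum_valP tnth_mktuple.
by move=> [] /eqP; rewrite eq_sym oner_eq0.
Qed.

Theorem theorem2 (R : realType) (n : nat) (G : rel 'I_n.+1)
    (hG : causal_graph G) (I : {set {set 'I_n}}) (hI : finset.set0 \in I) :
  (forall W : {set 'I_n}, identifiable I (@ACE R n G W)) <->
  ([set: 'I_n]%SET \in I /\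
   forall i : 'I_n, exists S : {set 'I_n},
     [/\ S \in I, i \notin S & Pa G i \subset S]).
Proof.
split=> [idI|[TI hS] W M1 M2 agr]; last exact: (ACE_eq hG hI agr).
split=> [|i]; first exact: full_intervention_needed (idI _).
exact: parents_intervention_needed (idI _).
Qed.
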